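(* Under the assumptions in the context, the dual of the linear program $$\max\{\langle\mu,r\rangle: L_0\mu=0,\ \langle\mu,1\rangle=1,\ L_1\mu\ge y,\ \mu\in\mathcal M_w(K),\ \mu\ge0\}$$ is $$\begin{aligned}\inf\quad&\beta-\langle\Lambda,y\rangle\\ \text{s.t.}\quad& r+L_0^*h-\beta\,1+L_1^*\Lambda\le0\ \text{ on }K,\\ &(h,\beta,\Lambda)\in\mathcal F_{\hat w}(S)\times\mathbb R\times\mathcal M([a,b]),\ \Lambda\ge0.\end{aligned}$$
   Context: $S$ and $A$ are Borel spaces; $A(s)\in\mathcal B(A)$ for $s\in S$; $K=\{(s,a): a\in A(s)\}$ is closed in $S\times A$; $Q(\cdot\mid s,a)$ is a stochastic kernel on $S$ given $K$; $r,z:K\to\mathbb R$ are measurable; $(x)_-=\min\{x,0\}$; $Y$ is a real random variable with support in a compact interval $[a,b]$ and $y(\eta)=\mathbb E[(Y-\eta)_-]$, $\eta\in[a,b]$. Let $w(s,a)=1-r(s,a)$ on $K$ and $\hat w(s)=1-\sup_{a\in A(s)}r(s,a)$ on $S$. $\mathcal M_w(K)$ is the space of signed Borel measures $\mu$ on $K$ with $\int_K w\,d|\mu|<\infty$; $\mathcal F_w(K)$ is the space of measurable $h:K\to\mathbb R$ with $\sup_K|h|/w<\infty$; they are paired by $\langle\mu,h\rangle=\int_K h\,d\mu$. $\mathcal M_{\hat w}(S)$ and $\mathcal F_{\hat w}(S)$ are defined and paired analogously. $\mathcal C([a,b])$ is paired with the finite signed Borel measures $\mathcal M([a,b])$ by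 $\langle\Lambda,f\rangle=\int_a^b f\,d\Lambda$. $L_0:\mathcal M_w(K)\to\mathcal M_{\hat w}(S)$, $[L_0\mu](B)=\hat\mu(B)-\int_K Q(B\mid s,a)\mu(d(s,a))$ ($\hat\mu$ = marginal on $S$), with adjoint $[L_0^*h](s,a)=h(s)-\int_S h(\xi)Q(d\xi\mid s,a)$. $L_1:\mathcal M_w(K)\to\mathcal C([a,b])$, $[L_1\mu](\eta)=\langle\mu,(z-\eta)_-\rangle$, with adjoint $[L_1^*\Lambda](s,a)=\int_a^b(z(s,a)-\eta)_-\Lambda(d\eta)$. **Meaning of ''dual''.** The Lagrangian is $\vartheta(\mu,h,\beta,\Lambda)=\langle\mu,r\rangle+\langle h,L_0\mu\rangle+\beta(\langle\mu,1\rangle-1)+\langle\Lambda,L_1\mu-y\rangle$, and the dual problem is $\inf_{(h,\beta,\Lambda),\,\Lambda\ge0}\ \sup_{\mu\in\mathcal M_w(K),\,\mu\ge0}\vartheta(\mu,h,\beta,\Lambda)$. The claim is that, after renaming the unrestricted variable $\beta$ as $-\beta$, the function $(h,\beta,\Lambda)\mapsto\sup_{\mu\ge0}\vartheta(\mu,h,-\beta,\Lambda)$ equals $\beta-\langle\Lambda,y\rangle$ where the displayed constraint holds and $+\infty$ elsewhere, so that the dual problem is the displayed one. **Assumptions.** $r\le0$ and $\{(s,a)\in K:r(s,a)\ge-\epsilon\}$ is compact for every $\epsilon\ge0$; $z$ is bounded and upper semicontinuous on $K$; $Q$ is weakly continuous ($\int_S h(\xi)Q(d\xi\mid\cdot)$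 is bounded continuous on $K$ for every bounded continuous $h$ on $S$); $(z-\eta)_-\in\mathcal F_w(K)$ for all $\eta\in[a,b]$; $\int_S\hat w(\xi)Q(d\xi\mid\cdot)\in\mathcal F_w(K)$. *)

(* Defs.v *)
From HB Require Import structures.
From mathcomp Require Import all_boot all_order all_algebra.
From mathcomp Require Import all_classical all_reals all_analysis measurable_realfun.
Set Implicit Arguments.
Unset Strict Implicit.
Unset Printing Implicit Defensive.
Import Order.TTheory GRing.Theory Num.Theory.
Import numFieldNormedType.Exports.
Local Open Scope classical_set_scope.
Local Open Scope ring_scope.

(* [T] is homeomorphic, via [f], to a Borel subset of a complete separable
   metric space [X]. *)
Definition borel_in_polish (R : realType) (T : topologicalType) : Prop :=
  exists (X : metricType R) (f : T -> X),
    [/\ forall F : set_system X, ProperFilter F -> cauchy F ->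
          exists x : X, F --> x,
        exists2 D : set X, countable D & dense D,
        injective f,
        forall U : set T, open U <-> exists2 V, open V & U = f @^-1` V &
        <<s @open X >> (range f)].

HB.mixin Record isBorelSpace (R : realType) d T
    & Topological T & Measurable d T := {
  measurable_borelE : @measurable d T = <<s @open T >> ;
  borel_polish : borel_in_polish R T
}.

#[short(type="borelSpaceType")]
HB.structure Definition BorelSpace (R : realType) d :=
  {T of Topological T & Measurable d T & isBorelSpace R d T}.

Section borel_product.
Context {R : realType} {d1 d2 : measure_display}.

Lemma borel_second_countable d (T : borelSpaceType R d) : @second_countable T.
Proof.
have [X [f [_ [D cD dD] _ openE _]]] := @borel_polish R d T.
pose g (p : X * nat) := f @^-1` (ball p.1 (p.2.+1%:R^-1 : R))°.
exists (g @` (D `*` setT)).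
  apply: sub_countable (card_image_le _ _) _.
  exact: countableX cD (countableP _).
split=> [_ [p _ <-]|x].
  apply/openE; exists (ball p.1 (p.2.+1%:R^-1 : R))° => //;
    exact: open_interior.
move=> U; rewrite nbhsE => -[W [/openE[V oV ->] /= Vfx] VU].
have /nbhs_ballP[e /= e0 eV] : nbhs (f x) V by exact: open_nbhs_nbhs.
have [k kE] : exists k : nat, k.+1%:R^-1 < e / 2.
  have [//|k] := @ltr_add_invr R 0 (e / 2); first by rewrite divr_gt0.
  by rewrite add0r => ke; exists k.
have k0 : 0 < k.+1%:R^-1 :> R by rewrite invr_gt0.
have [y [/interior_subset yx Dy]] :
    (ball (f x) (k.+1%:R^-1 / 2 : R))° `&` D !=set0.
  apply: dD; last exact: open_interior.
  exists (f x); apply: nbhsx_ballx; exact: divr_gt0.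
exists (g (y, k)).
  split; first by exists (y, k).
  rewrite /g /=; apply/nbhs_ballP; exists (k.+1%:R^-1 / 2); first exact: divr_gt0.
  move=> t xt; rewrite [X in ball _ X](splitr (k.+1%:R^-1 : R)).
  exact: ball_triangle (ball_sym yx) xt.
move=> t /= /interior_subset /= yt; apply: VU; apply: eV => /=.
rewrite [e]splitr; apply: (@ball_triangle _ _ y).
  apply: le_ball yx; rewrite ler_pdivrMr// (le_trans (ltW kE))// ler_peMr ?ler1n//.
  exact/ltW/divr_gt0.
by apply: le_ball yt; exact: ltW.
Qed.

Lemma open_measurable_borel d (T : borelSpaceType R d) (U : set T) :
  open U -> measurable U.
Proof. by move=> oU; rewrite (@measurable_borelE R); exact: sub_sigma_algebra. Qed.

Lemma closed_measurable_prod (S : borelSpaceType R d1) (A : borelSpaceType R d2)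
  (K : set (S * A)) : closed K -> measurable K.
Proof.
move=> cK; rewrite -(setCK K); apply: measurableC.
move: (closed_openC cK); move: (~` K) => W oW {K cK}.
have [B1 cB1 [oB1 bB1]] := borel_second_countable S.
have [B2 cB2 [oB2 bB2]] := borel_second_countable A.
pose F := [set p : set S * set A | [/\ B1 p.1, B2 p.2 & p.1 `*` p.2 `<=` W]].
have -> : W = \bigcup_(p in F) (p.1 `*` p.2).
  apply/seteqP; split=> [[s t] Wst|st [p [_ _ pW] pst]]; last exact: pW.
  have : nbhs (s, t) W by exact: open_nbhs_nbhs.
  case=> -[/= P Q] /= [Ps Qt] PQW.
  have [U [BU Us] UP] := bB1 s P Ps.
  have [V [BV Vt] VQ] := bB2 t Q Qt.
  exists (U, V) => //; split => //= -[s' t'] /= [Us' Vt'].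
  by apply: PQW; split; [exact: UP|exact: VQ].
have cF : countable F.
  apply: sub_countable (subset_card_le _) (countableX cB1 cB2).
  by move=> p [].
have mF p : F p -> measurable (p.1 `*` p.2).
  by move=> [p1 p2 _]; apply: measurableX; apply: open_measurable_borel;
    [exact: oB1|exact: oB2].
have /pfcard_geP[->|[f]] := cF; first by rewrite bigcup_set0.
rewrite (reindex_bigcup f setT)//.
by apply: bigcupT_measurable => n; apply: mF; exact: funS.
Qed.

End borel_product.

Section charges.
Context {d : measure_display} {T : measurableType d} {R : realType}.
Implicit Types (mu : {charge set T -> \bar R}) (D : set T).

Lemma ex_hahn mu : exists PN : set T * set T, hahn_decomposition mu PN.1 PN.2.
Proof. by have [P [N PN]] := Hahn_decomposition mu; exists (P, N). Qed.

Definition charge_pos mu : {finite_measure set T -> \bar R} :=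
  jordan_pos (projT2 (cid (ex_hahn mu))).

Definition charge_neg mu : {finite_measure set T -> \bar R} :=
  jordan_neg (projT2 (cid (ex_hahn mu))).

Definition charge_abs mu : {measure set T -> \bar R} :=
  charge_variation (projT2 (cid (ex_hahn mu))).

(* The signed measures on a measurable [D] are represented by the charges on
   the whole of [T] that are carried by [D]. *)
Definition carried_by D mu : Prop :=
  forall B, measurable B -> B `<=` ~` D -> mu B = 0%E.

Definition charge_ge0 mu : Prop := forall B, measurable B -> (0 <= mu B)%E.

Definition pairing D mu (h : T -> R) : R :=
  \int[charge_pos mu]_(x in D) h x - \int[charge_neg mu]_(x in D) h x.

(* The weights are extended-real-valued only because [mdp_what] below is +oo at
   a state without admissible action; note that [x / +oo = 0]. *)
Definition weighted_charges D (w : T -> \bar R)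
    : set (charge T R) :=
  [set mu | carried_by D mu /\ (\int[charge_abs mu]_(x in D) w x < +oo)%E].

Definition weighted_functions D (w : T -> \bar R) : set (T -> R) :=
  [set h : T -> R | measurable_fun D h /\
    (ereal_sup [set `|h x|%:E / w x | x in D] < +oo)%E].

End charges.

Definition negpart {R : realType} (x : R) : R := Num.min x 0.

Definition graph {S A : Type} (F : S -> set A) : set (S * A) :=
  [set x | F x.1 x.2].

(* Functions and kernels on K = graph mdp_act are represented by functions on
   S * A of which only the restriction to K is used. *)
Record mdp (R : realType) (dS dA : measure_display)
    (S : borelSpaceType R dS) (A : borelSpaceType R dA) := Mdp {
  mdp_act : S -> set A ;
  mdp_act_measurable : forall s, measurable (mdp_act s) ;
  mdp_graph_closed : closed (graph mdp_act) ;
  mdp_kernel : S * A -> probability S R ;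
  mdp_kernel_measurable : forall B : set S, measurable B ->
    measurable_fun (graph mdp_act) (mdp_kernel ^~ B) ;
  mdp_r : S * A -> R ;
  mdp_r_measurable : measurable_fun (graph mdp_act) mdp_r ;
  mdp_z : S * A -> R ;
  mdp_z_measurable : measurable_fun (graph mdp_act) mdp_z
}.

Section operators.
Context {R : realType} {dS dA : measure_display}
  {S : borelSpaceType R dS} {A : borelSpaceType R dA} (M : mdp S A).
Local Notation Q := (mdp_kernel M).
Local Notation r := (mdp_r M).
Local Notation z := (mdp_z M).
Implicit Types (mu : {charge set (S * A)%type -> \bar R})
  (Lam : {charge set R -> \bar R}) (h : S -> R) (a b : R).

Definition mdp_K : set (S * A) := graph (mdp_act M).
Local Notation K := mdp_K.

Lemma mdp_K_measurable : measurable K.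
Proof. exact: closed_measurable_prod (mdp_graph_closed (m := M)). Qed.

Definition mdp_w (x : S * A) : \bar R := (1 - r x)%:E.

Definition mdp_what (s : S) : \bar R :=
  (1 - ereal_sup [set (r (s, a))%:E | a in mdp_act M s])%E.

Section kernel_image.
Variable m : {finite_measure set (S * A)%type -> \bar R}.

Definition kernel_image (B : set S) : \bar R := (\int[m]_(x in K) Q x B)%E.

Let kernel_image0 : kernel_image set0 = 0%E.
Proof. by rewrite /kernel_image integral0_eq// => x _; rewrite measure0. Qed.

Let kernel_image_ge0 B : (0 <= kernel_image B)%E.
Proof. by apply: integral_ge0 => x _; exact: measure_ge0. Qed.

Let kernel_image_sigma_additive : semi_sigma_additive kernel_image.
Proof.
move=> F mF tF mUF; rewrite /kernel_image.
have -> : (\int[m]_(x in K) Q x (\bigcup_n F n) =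
    \sum_(0 <= n <oo) \int[m]_(x in K) Q x (F n))%E.
  rewrite -integral_nneseries//.
  - apply: eq_integral => x _; apply/esym/cvg_lim => //.
    exact: measure_semi_sigma_additive.
  - exact: mdp_K_measurable.
  - by move=> n; exact: mdp_kernel_measurable.
by apply: is_cvg_nneseries => n _ _; apply: integral_ge0 => x _.
Qed.

HB.instance Definition _ := isMeasure.Build _ S R kernel_image
  kernel_image0 kernel_image_ge0 kernel_image_sigma_additive.

Let kernel_image_finite : fin_num_fun kernel_image.
Proof.
move=> B mB; rewrite ge0_fin_numE//.
apply: (@le_lt_trans _ _ (\int[m]_(x in K) (cst 1 x))%E).
  apply: ge0_le_integral => //.
  - exact: mdp_K_measurable.
  - exact: mdp_kernel_measurable.
  - by move=> x _; exact: probability_le1.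
rewrite integral_cst; last exact: mdp_K_measurable.
by rewrite mul1e ltey_eq fin_num_measure//; exact: mdp_K_measurable.
Qed.

HB.instance Definition _ := @Measure_isFinite.Build _ _ _
  kernel_image kernel_image_finite.

End kernel_image.

Definition kernel_charge mu : {charge set S -> \bar R} :=
  cadd (charge_of_finite_measure (kernel_image (charge_pos mu)))
    (copp (charge_of_finite_measure (kernel_image (charge_neg mu)))).

Section marginal.
Variable mu : {charge set (S * A)%type -> \bar R}.

Definition marginal : set S -> \bar R := pushforward mu fst.

Let measurable_cylinder (B : set S) :
  measurable B -> measurable ((fst : S * A -> S) @^-1` B).
Proof. by move=> mB; rewrite -[X in measurable X]setTI; exact: measurable_fst. Qed.

Let marginal0 : marginal set0 = 0%E.
Proof. by rewrite /marginal /pushforward preimage_set0 charge0. Qed.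

Let marginal_finite B : measurable B -> marginal B \is a fin_num.
Proof.
move=> mB; rewrite /marginal /pushforward; apply: fin_num_measure.
exact: measurable_cylinder.
Qed.

Let marginal_sigma_additive : semi_sigma_additive marginal.
Proof.
move=> F mF tF mUF; rewrite /marginal /pushforward preimage_bigcup.
apply: charge_semi_sigma_additive.
- by move=> n; exact: measurable_cylinder.
- apply/trivIsetP => /= i j _ _ ij; rewrite -preimage_setI.
  by move/trivIsetP : tF => /(_ _ _ _ _ ij) ->//; rewrite preimage_set0.
- by rewrite -preimage_bigcup; exact: measurable_cylinder.
Qed.

HB.instance Definition _ := isCharge.Build _ S R marginal
  marginal0 marginal_finite marginal_sigma_additive.

End marginal.

Definition mdp_L0 mu : {charge set S -> \bar R} :=
  cadd (marginal mu) (copp (kernel_charge mu)).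

Lemma mdp_L0E mu (B : set S) :
  mdp_L0 mu B = (mu (fst @^-1` B) -
    (\int[charge_pos mu]_(x in K) Q x B
     - \int[charge_neg mu]_(x in K) Q x B))%E.
Proof. by []. Qed.

Definition mdp_L0adj h (x : S * A) : R := h x.1 - \int[Q x]_s h s.

Definition mdp_L1 mu (eta : R) : R :=
  pairing K mu (fun x => negpart (z x - eta)).

Definition mdp_L1adj a b Lam (x : S * A) : R :=
  pairing `[a, b] Lam (fun eta : R => negpart (z x - eta)).

Definition lagrangian a b (y : R -> R) mu h (beta : R) Lam : R :=
  pairing K mu r + pairing setT (mdp_L0 mu) h
  + beta * (pairing K mu (cst 1) - 1)
  + pairing `[a, b] Lam (fun eta => mdp_L1 mu eta - y eta).

Definition dual_function a b (y : R -> R) h (beta : R) Lam : \bar R :=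
  ereal_sup [set (lagrangian a b y mu h beta Lam)%:E |
    mu in weighted_charges K mdp_w `&` charge_ge0].

Definition multipliers a b
    : set ((S -> R) * R * charge R R) :=
  [set m | [/\ weighted_functions setT mdp_what m.1.1,
               carried_by `[a, b] m.2 & charge_ge0 m.2]].

Definition dual_constraint a b h (beta : R) Lam : Prop :=
  forall x, K x -> r x + mdp_L0adj h x - beta + mdp_L1adj a b Lam x <= 0.

Definition dual_objective a b (y : R -> R) (beta : R) Lam : R :=
  beta - pairing `[a, b] Lam y.

End operators.

Definition shortfall d (T : measurableType d) (R : realType)
    (P : probability T R) (Y : {RV P >-> R}) (eta : R) : R :=
  fine 'E_P[fun t => negpart (Y t - eta)].

(* Main.v *)
Require Import Defs.
From HB Require Import structures.
From mathcomp Require Import all_boot all_order all_algebra.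
From mathcomp Require Import all_classical all_reals all_analysis measurable_realfun lra.
Import Order.TTheory GRing.Theory Num.Theory.
Import numFieldNormedType.Exports.
Local Open Scope classical_set_scope.
Local Open Scope ring_scope.

(** For [mu >= 0] every pairing in the Lagrangian is an absolutely convergent
    integral against the finite measure [mu], so by Fubini (for [L1], whose
    kernel is bounded) and by integrating against the image of [mu] under [Q]
    (for [L0]) the Lagrangian at [(h, -beta, Lam)] is
    [\int_K g dmu + beta - <Lam, y>] with [g = r + L0^* h - beta + L1^* Lam].
    If [g <= 0] on [K] the supremum is attained at [mu = 0]; if [g x > 0], the
    multiples of the Dirac mass at [x] make it infinite. *)

(** * Jordan parts of nonnegative charges, and pairing with a difference of measures *)

Section nonnegative_charges.
Context {d : measure_display} {T : measurableType d} {R : realType}.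
Implicit Types (nu : {charge set T -> \bar R}) (B D : set T).

(** The Jordan parts rest on a chosen Hahn decomposition. Only its positive set is exposed: the
    negative set is the complement, by the partition property. *)
Lemma charge_posE nu : exists2 P : set T, measurable P &
  (forall B, measurable B -> charge_pos nu B = nu (B `&` P)) /\
  (forall B, measurable B -> charge_neg nu B = (- nu (B `&` ~` P))%E).
Proof.
rewrite /charge_pos /charge_neg.
case: (projT2 _) => -[mP pP] [mN nN] PNT PN0.
set P := (projT1 _).1 in mP pP PNT PN0 *.
set N := (projT1 _).2 in mN nN PNT PN0 *.
exists P => //.
have -> : ~` P = N.
  apply/seteqP; split=> x.
    by move=> nPx; have : (P `|` N) x by [rewrite PNT|]; case.
  by move=> Nx Px; have : (P `&` N) x by []; rewrite PN0.
split=> B mB.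
  by transitivity (crestr0 nu mP B) => //; rewrite /crestr0 mem_set.
transitivity (cscale (-1) (crestr0 nu mN) B) => //.
by rewrite cscaleN1 /= /crestr0 mem_set.
Qed.

(** The value is nonnegative as that of a measure, and nonpositive as the opposite of a value of
    [nu]. *)
Lemma charge_neg_ge0 nu B : charge_ge0 nu -> measurable B ->
  charge_neg nu B = 0%E.
Proof.
move=> nu0 mB; have [P mP [posE negE]] := charge_posE nu.
have mBP : measurable (B `&` ~` P).
  by apply: measurableI => //; exact: measurableC.
apply/eqP; rewrite eq_le measure_ge0 andbT negE//.
by rewrite oppe_le0; exact: nu0.
Qed.

Lemma charge_pos_ge0 nu B : charge_ge0 nu -> measurable B ->
  charge_pos nu B = nu B.
Proof.
move=> nu0 mB; have [P mP [posE negE]] := charge_posE nu.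
have mBP : measurable (B `&` ~` P).
  by apply: measurableI => //; exact: measurableC.
have := charge_neg_ge0 nu B nu0 mB.
rewrite posE// negE// => /eqP; rewrite oppe_eq0 => /eqP nuN.
rewrite -[in RHS](setIT B) -(setUCr P) setIUr chargeU//.
- by rewrite nuN adde0.
- exact: measurableI.
- by rewrite setIACA setICr setI0.
Qed.

Lemma pairing_ge0 nu D (h : T -> R) : charge_ge0 nu -> measurable D ->
  pairing D nu h = \int[charge_pos nu]_(x in D) h x.
Proof.
move=> nu0 mD; rewrite /pairing [X in _ - X](_ : _ = 0) ?subr0//.
rewrite /Rintegral (eq_measure_integral mzero) ?integral_measure_zero//.
by move=> B mB _; exact: charge_neg_ge0.
Qed.

Lemma integral_charge_abs nu D (f : T -> \bar R) : charge_ge0 nu ->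
  (\int[charge_abs nu]_(x in D) f x = \int[charge_pos nu]_(x in D) f x)%E.
Proof.
move=> nu0; apply: eq_measure_integral => B mB _.
by rewrite -[RHS]adde0 -(charge_neg_ge0 nu B nu0 mB).
Qed.

(** Meant for [mdp_L0 mu], which is signed even when [mu] is nonnegative and comes as a difference
    of finite measures that need not be mutually singular. The Jordan parts are minimal, hence
    dominated by [m1] and [m2], so [h] is integrable against them as well. *)
Lemma pairing_diff nu (m1 m2 : {measure set T -> \bar R}) (h : T -> R) :
  (forall B, measurable B -> m1 B \is a fin_num) ->
  (forall B, measurable B -> m2 B \is a fin_num) ->
  (forall B, measurable B -> nu B = m1 B - m2 B)%E ->
  m1.-integrable setT (EFin \o h) -> m2.-integrable setT (EFin \o h) ->
  pairing setT nu h = \int[m1]_x h x - \int[m2]_x h x.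
Proof.
move=> fm1 fm2 nuE h1 h2; have [P mP [posE negE]] := charge_posE nu.
have mh : measurable_fun setT (EFin \o h) by exact: measurable_int h1.
have le_int (n1 n2 : {measure set T -> \bar R}) :
    (forall B, measurable B -> n1 B <= n2 B)%E ->
    n2.-integrable setT (EFin \o h) -> n1.-integrable setT (EFin \o h).
  move=> n12 /integrableP[_ ih]; apply/integrableP; split => //.
  by apply: le_lt_trans ih; apply: ge0_le_measure_integral => //;
    exact: measurableT_comp.
have mI B C : measurable B -> measurable C -> measurable (B `&` C).
  by move=> mB mC; exact: measurableI.
have mCP : measurable (~` P) by exact: measurableC.
have sub_le (n1 n2 : {measure set T -> \bar R}) B C : measurable B ->
    measurable C -> (n1 (B `&` C) - n2 (B `&` C) <= n1 B)%E.
  move=> mB mC; rewrite (@le_trans _ _ (n1 (B `&` C)))//.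
    by rewrite -[leRHS]sube0 leeB.
  by apply: le_measure; rewrite ?inE//; exact: mI.
have ipos : (charge_pos nu).-integrable setT (EFin \o h).
  apply: le_int h1 => B mB; rewrite [leLHS]posE// nuE; last exact: mI.
  exact: sub_le.
have ineg : (charge_neg nu).-integrable setT (EFin \o h).
  apply: le_int h2 => B mB; rewrite [leLHS]negE// nuE; last exact: mI.
  rewrite fin_num_oppeB; last exact/fm2/mI.
  by rewrite addeC; exact: sub_le.
(* Cross-addition turns the two decompositions of [nu] into an equality of measures, which can be
   integrated by additivity in the measure. *)
have addE B : measurable B ->
    (charge_pos nu B + m2 B = m1 B + charge_neg nu B)%E.
  move=> mB; have nuB : (m1 B - m2 B = charge_pos nu B - charge_neg nu B)%E.
    rewrite -nuE// posE// negE// oppeK -chargeU; [|exact: mI|exact: mI|].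
      by rewrite -setIUr setUCr setIT.
    by rewrite setIACA setICr setI0.
  rewrite -[in RHS](subeK (m1 B) (fm2 B mB)) nuB [RHS]addeAC subeK//.
  exact: fin_num_measure.
have : (\int[charge_pos nu]_x (h x)%:E + \int[m2]_x (h x)%:E =
        \int[m1]_x (h x)%:E + \int[charge_neg nu]_x (h x)%:E)%E.
  rewrite -!integral_measure_add//.
  apply: eq_measure_integral => B mB _.
  by apply: eq_trans (measure_addE _ _ _) _; rewrite [LHS]addE// -measure_addE.
rewrite /pairing /Rintegral.
have := integrable_fin_num measurableT ipos.
have := integrable_fin_num measurableT ineg.
have := integrable_fin_num measurableT h1.
have := integrable_fin_num measurableT h2.
move=> /= /fineK <- /fineK <- /fineK <- /fineK <- [] /=.
by lra.
Qed.

End nonnegative_charges.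

(* No measurability is assumed on [g]: this is applied to [g = \hat w]. *)
Lemma ge0_le_integralT d (T : measurableType d) (R : realType)
  (m : {measure set T -> \bar R}) (f g : T -> \bar R) :
  (forall x, 0 <= f x)%E -> (forall x, f x <= g x)%E ->
  (\int[m]_x f x <= \int[m]_x g x)%E.
Proof.
move=> f0 fg; rewrite !ge0_integralTE//; last first.
  by move=> x; exact: le_trans (fg x).
apply: le_ereal_sup => _ [u uf <-]; exists u => // x.
exact: le_trans (uf x) (fg x).
Qed.

(** * Integration against the image of a measure under the kernel *)

Section kernel_integral.
Context {R : realType} {dS dA : measure_display}
  {S : borelSpaceType R dS} {A : borelSpaceType R dA} (M : mdp S A)
  (m : {finite_measure set (S * A)%type -> \bar R}).
Local Notation Q := (mdp_kernel M).
Local Notation K := (mdp_K M).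

Let mK : measurable K. Proof. exact: mdp_K_measurable. Qed.

(* [integral_kcomp] needs kernels that are measurable on the whole space and a
   parametrized outer measure, whence the extension of [Q] by [0] outside [K]
   and the constant kernel [m]. *)
Let QK (p : (S * A) * (S * A)) : {measure set S -> \bar R} :=
  if p.2 \in K then (Q p.2 : {measure set S -> \bar R}) else mzero.

Let measurable_QK (B : set S) : measurable B ->
  measurable_fun [set: (S * A) * (S * A)] (QK ^~ B).
Proof.
move=> mB; rewrite (_ : QK ^~ B = ((Q ^~ B) \_ K) \o snd).
  apply: (measurableT_comp (f := (Q ^~ B) \_ K)); last exact: measurable_snd.
  exact: (measurable_restrictT _ mK).1 (mdp_kernel_measurable mB).
by apply/funext => p; rewrite /QK /= patchE; case: ifPn.
Qed.

HB.instance Definition _ := isKernel.Build _ _ _ _ R QK measurable_QK.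

Let QK_uub : measure_fam_uub QK.
Proof.
(* The uniform bound must be strict, and [Q] has mass 1. *)
exists 2 => p; rewrite /QK; case: ifPn => _ /=; last by rewrite lte_fin.
by rewrite probability_setT lte_fin ltr1n.
Qed.

HB.instance Definition _ := Kernel_isFinite.Build _ _ _ _ R QK QK_uub.

Let mcst (_ : S * A) : {measure set (S * A)%type -> \bar R} := m.

Let measurable_mcst (B : set (S * A)) : measurable B ->
  measurable_fun [set: S * A] (mcst ^~ B).
Proof. by move=> _; exact: measurable_cst. Qed.

HB.instance Definition _ := isKernel.Build _ _ _ _ R mcst measurable_mcst.

Let mcst_uub : measure_fam_uub mcst.
Proof.
exists (fine (m setT) + 1) => x; rewrite /mcst EFinD fineK ?fin_num_measure//.
by rewrite lteDl ?fin_num_measure// lte_fin.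
Qed.

HB.instance Definition _ := Kernel_isFinite.Build _ _ _ _ R mcst mcst_uub.

Lemma measurable_integral_kernel (f : S -> \bar R) : (forall s, 0 <= f s)%E ->
  measurable_fun setT f -> measurable_fun K (fun x => \int[Q x]_s f s)%E.
Proof.
move=> f0 mf.
(* Restricting to the diagonal is harmless: [QK] reads only its second argument. *)
have : measurable_fun setT (fun x : S * A => \int[QK (x, x)]_s f s)%E.
  apply: measurable_fun_integral_kernel => // B mB.
  apply: (measurableT_comp (measurable_QK _ mB)).
  exact: measurable_fun_pair.
move=> /(measurable_funTS (D := K)).
by apply: eq_measurable_fun => x xK; rewrite /QK/= xK.
Qed.

(** [kernel_image M m] is the composite of the constant kernel [m] with [QK]; where the constant
    kernel is evaluated is immaterial, hence [point]. *)
Lemma ge0_integral_kernel_image (f : S -> \bar R) : (forall s, 0 <= f s)%E ->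
  measurable_fun setT f ->
  (\int[kernel_image M m]_s f s = \int[m]_(x in K) \int[Q x]_s f s)%E.
Proof.
move=> f0 mf; transitivity (\int[kcomp mcst QK point]_s f s)%E.
  apply: eq_measure_integral => B mB _.
  rewrite /kcomp /= /kernel_image integral_mkcond; apply: eq_integral => x _.
  by rewrite patchE /QK/=; case: ifPn.
rewrite integral_kcomp// [RHS]integral_mkcond; apply: eq_integral => x _.
rewrite patchE; case: ifPn => xK.
  by apply: eq_measure_integral => B mB _; rewrite /= /QK/= xK.
rewrite (eq_measure_integral mzero) ?integral_measure_zero// => B mB _.
by rewrite /= /QK/= (negbTE xK).
Qed.

(** The nonnegative formula is applied to the positive and negative parts of [h]; the finite
    iterated integral of the absolute value allows subtracting the results. *)
Lemma Rintegral_kernel_image (h : S -> R) : measurable_fun setT h ->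
  (\int[m]_(x in K) \int[Q x]_s `|h s|%:E < +oo)%E ->
  (forall x, K x -> (Q x).-integrable setT (EFin \o h)) ->
  [/\ (kernel_image M m).-integrable setT (EFin \o h),
      m.-integrable K (fun x => (\int[Q x]_s h s)%:E) &
      \int[kernel_image M m]_s h s = \int[m]_(x in K) \int[Q x]_s h s].
Proof.
move=> mh hoo Qh.
have mEh : measurable_fun setT (EFin \o h) by exact/measurable_EFinP.
have ih : (kernel_image M m).-integrable setT (EFin \o h).
  apply/integrableP; split => //.
  by rewrite ge0_integral_kernel_image//; exact: measurableT_comp.
pose F (f : S -> \bar R) x := (\int[Q x]_s f s)%E.
have mp : measurable_fun setT ((EFin \o h)^\+)%E by exact: measurable_funepos.
have mn : measurable_fun setT ((EFin \o h)^\-)%E by exact: measurable_funeneg.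
have iF (f : S -> \bar R) : measurable_fun setT f -> (forall s, 0 <= f s)%E ->
    (forall s, f s <= `|h s|%:E)%E -> m.-integrable K (F f).
  move=> mf f0 fh; have mF := measurable_integral_kernel _ f0 mf.
  apply/integrableP; split => //; apply: le_lt_trans hoo.
  apply: ge0_le_integral => //.
  - exact: measurableT_comp.
  - apply: measurable_integral_kernel => //.
    exact/measurable_EFinP/measurableT_comp.
  - move=> x _; rewrite gee0_abs ?integral_ge0//.
    by apply: ge0_le_integral => //; exact/measurable_EFinP/measurableT_comp.
have absE s : (`|h s|%:E = ((EFin \o h)^\+)%E s + ((EFin \o h)^\-)%E s)%E.
  exact: (congr1 (@^~ s) (fune_abse (EFin \o h))).
have iFp : m.-integrable K (F ((EFin \o h)^\+)%E).
  by apply: iF => // s; rewrite absE leeDl.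
have iFn : m.-integrable K (F ((EFin \o h)^\-)%E).
  by apply: iF => // s; rewrite absE leeDr.
have FE : {in K, (F ((EFin \o h)^\+)%E \- F ((EFin \o h)^\-)%E)%E =1
    (fun x => (\int[Q x]_s h s)%:E)}.
  move=> x /set_mem Kx; rewrite /Rintegral fineK.
    by rewrite [RHS]integralE.
  exact: integrable_fin_num (Qh _ Kx).
split => //.
  by apply: eq_integrable FE _ => //; exact: integrableB.
rewrite /Rintegral integralE !ge0_integral_kernel_image//.
by rewrite -integralB//; congr fine; exact: eq_integral.
Qed.

End kernel_integral.


(** * Fubini for bounded functions on a rectangle *)

Lemma bounded_integrable d (T : measurableType d) (R : realType)
  (m : {finite_measure set T -> \bar R}) (D : set T) (f : T -> R) (C : R) :
  measurable D -> measurable_fun D f -> (forall x, D x -> `|f x| <= C) ->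
  m.-integrable D (EFin \o f).
Proof.
move=> mD mf fC; apply: measurable_bounded_integrable => //.
  by rewrite -ge0_fin_numE//; exact: fin_num_measure.
exists C; split => [|y Cy x /fC fxC]; first exact: num_real.
exact: le_trans (ltW Cy).
Qed.

Section bounded_fubini.
Context {d1 d2 : measure_display} {T1 : measurableType d1}
  {T2 : measurableType d2} {R : realType}.
Variables (m1 : {finite_measure set T1 -> \bar R})
  (m2 : {finite_measure set T2 -> \bar R}).
Variables (D1 : set T1) (D2 : set T2) (f : T1 * T2 -> R) (C : R).
Hypotheses (mD1 : measurable D1) (mD2 : measurable D2).
Hypotheses (mf : measurable_fun (D1 `*` D2) f)
  (fC : forall x y, D1 x -> D2 y -> `|f (x, y)| <= C).

Let mD : measurable (D1 `*` D2). Proof. exact: measurableX. Qed.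

(** Extension by 0 off the rectangle, so that Fubini on the whole product applies. *)
Let g : T1 * T2 -> \bar R := (EFin \o f) \_ (D1 `*` D2).

Let ig : (m1 \x m2)%E.-integrable setT g.
Proof.
apply: (integrable_mkcond (EFin \o f) mD).1.
apply: measurable_bounded_integrable => //.
  rewrite [ltLHS]product_measure1E// lte_mul_pinfty//.
    exact: fin_num_measure.
  by rewrite -ge0_fin_numE//; exact: fin_num_measure.
exists C; split => [|y Cy [x1 x2] [/= Dx1 Dx2]]; first exact: num_real.
exact: le_trans (fC _ _ Dx1 Dx2) (ltW Cy).
Qed.

Let i1 y : D2 y -> m1.-integrable D1 (EFin \o (fun x => f (x, y))).
Proof.
move=> Dy; apply: (bounded_integrable _ _ _ _ _ _ C) => //; last first.
  by move=> x Dx; exact: fC.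
apply: (measurable_comp (F := D1 `*` D2)) => //.
  by move=> _ [x Dx <-].
exact/measurable_funTS/pair2_measurable.
Qed.

Let i2 x : D1 x -> m2.-integrable D2 (EFin \o (fun y => f (x, y))).
Proof.
move=> Dx; apply: (bounded_integrable _ _ _ _ _ _ C) => //; last first.
  by move=> y Dy; exact: fC.
apply: (measurable_comp (F := D1 `*` D2)) => //.
  by move=> _ [y Dy <-].
exact/measurable_funTS/pair1_measurable.
Qed.

Let FE : fubini_F m2 g = (fun x => (\int[m2]_(y in D2) f (x, y))%:E) \_ D1.
Proof.
apply/funext => x; rewrite /fubini_F patchE; case: ifPn => xD.
  rewrite /Rintegral fineK.
    rewrite [RHS]integral_mkcond; apply: eq_integral => y _.
    by rewrite /g !patchE in_setX/= xD.
  by apply: integrable_fin_num => //; apply: i2; exact: set_mem.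
by rewrite integral0_eq// => y _; rewrite /g patchE in_setX/= (negbTE xD).
Qed.

Let GE : fubini_G m1 g = (fun y => (\int[m1]_(x in D1) f (x, y))%:E) \_ D2.
Proof.
apply/funext => y; rewrite /fubini_G patchE; case: ifPn => yD.
  rewrite /Rintegral fineK.
    rewrite [RHS]integral_mkcond; apply: eq_integral => x _.
    by rewrite /g !patchE in_setX/= yD andbT.
  by apply: integrable_fin_num => //; apply: i1; exact: set_mem.
by rewrite integral0_eq// => x _; rewrite /g patchE in_setX/= (negbTE yD) andbF.
Qed.

Lemma bounded_fubini :
  [/\ m1.-integrable D1 (fun x => (\int[m2]_(y in D2) f (x, y))%:E),
      m2.-integrable D2 (fun y => (\int[m1]_(x in D1) f (x, y))%:E) &
      \int[m1]_(x in D1) \int[m2]_(y in D2) f (x, y) =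
      \int[m2]_(y in D2) \int[m1]_(x in D1) f (x, y)].
Proof.
split.
- apply: (integrable_mkcond _ mD1).2; rewrite -FE.
  exact: integrable_fubini_F.
(* The bound is the integral of the constant [C] over [D1]. *)
- apply: (bounded_integrable _ _ _ _ _ _ (C * fine (m1 D1))) => //.
    apply/measurable_EFinP; apply: (measurable_restrictT _ mD2).2.
    rewrite -[X in measurable_fun _ X]GE; exact: measurable_fubini_G ig.
  move=> y Dy; apply: (le_trans (le_normr_Rintegral mD1 (i1 _ Dy))).
  rewrite -Rintegral_cst//; apply: le_Rintegral => //.
  - exact: integrable_norm (i1 _ Dy).
  - exact: finite_measure_integrable_cst.
  - by move=> x Dx; exact: fC.
- rewrite /Rintegral [in LHS]integral_mkcond [in RHS]integral_mkcond.
  by rewrite -FE -GE; congr fine; exact: Fubini.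
Qed.

End bounded_fubini.

(** * Measurability and boundedness of the shortfall function *)

Section shortfall.
Context {d : measure_display} {T : measurableType d} {R : realType}
  (P : probability T R) (Y : {RV P >-> R}).

(** The sign is reversed for nonnegativity, and threshold and outcome are joint variables, so that
    Tonelli yields measurability in the threshold. *)
Let loss (p : R * T) : \bar R := (- negpart (Y p.2 - p.1))%:E.

Let loss_ge0 p : (0 <= loss p)%E.
Proof. by rewrite lee_fin oppr_ge0 ge_min lexx orbT. Qed.

Let measurable_loss : measurable_fun setT loss.
Proof.
apply/measurable_EFinP/measurable_funN/measurable_minr => //.
apply: measurable_funB; last exact: measurable_fst.
by apply: measurableT_comp => //; exact: measurable_snd.
Qed.

Let shortfallE eta : shortfall Y eta = - fine (\int[P]_t loss (eta, t))%E.
Proof.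
rewrite /shortfall unlock.
rewrite (eq_integral (fun t => - loss (eta, t))%E); last first.
  by move=> t _; rewrite /loss /= opprK.
rewrite integral_ge0N ?fineN//.
Qed.

Lemma measurable_shortfall : measurable_fun setT (shortfall Y).
Proof.
rewrite (funext shortfallE); apply/measurable_funN.
apply: measurableT_comp => //.
exact: measurable_fun_fubini_tonelli_F.
Qed.

Lemma shortfall_bounded (a b eta : R) : P (Y @^-1` `[a, b]) = 1%E ->
  eta \in `[a, b] -> `|shortfall Y eta| <= b - a.
Proof.
move=> Yab; rewrite in_itv/= => /andP[aeta etab].
rewrite shortfallE normrN.
have mI : measurable (Y @^-1` `[a, b]).
  by rewrite -[X in measurable X]setTI; exact: measurable_funPT.
have mL : measurable_fun setT (fun t => loss (eta, t)).
  by apply: measurableT_comp => //.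
have : (\int[P]_t loss (eta, t) <= (b - a)%:E)%E.
  (* The null event that [Y] leaves [[a, b]] is discarded; elsewhere the loss is the maximum of
     [eta - Y] and 0, at most [b - a]. *)
  rewrite (ge0_negligible_integral (N := ~` (Y @^-1` `[a, b])))//.
  - rewrite setTD setCK.
    apply: (@le_trans _ _
      (\int[P]_(t in Y @^-1` `[a, b]) (cst (b - a)%:E t))%E).
      apply: ge0_le_integral => //.
      - exact: measurable_funTS.
      - move=> t /=; rewrite in_itv/= => /andP[aY Yb].
        rewrite lee_fin /negpart oppr_min opprB oppr0 ge_max.
        by rewrite /=; apply/andP; split; lra.
    by rewrite integral_cst//= [P _]Yab mule1.
  - exact: measurableC.
  - by rewrite [LHS]probability_setC// [P _]Yab subee.
have : (0 <= \int[P]_t loss (eta, t))%E by exact: integral_ge0.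
case: (\int[P]_t _)%E => [r| |]//=; rewrite !lee_fin => r0 rb.
by rewrite ger0_norm.
Qed.

End shortfall.

(** * Weighted bounds and the adjoint identity for [mdp_L0] *)

Lemma weighted_functions_bound d (T : measurableType d) (R : realType)
  (D : set T) (w : T -> \bar R) (h : T -> R) :
  (forall x, D x -> 1 <= w x)%E -> weighted_functions D w h ->
  exists2 C : R, 0 < C & forall x, D x -> (`|h x|%:E <= C%:E * w x)%E.
Proof.
move=> w1 [_ hw].
have [C C0 hC] : exists2 C : R, 0 < C &
    forall x, D x -> (`|h x|%:E / w x <= C%:E)%E.
  pose V := [set `|h x|%:E / w x | x in D]%E.
  case: ereal_sup hw (@ereal_sup_ubound _ V) => [c _ ub|//|_ ub].
    exists (`|c| + 1) => [|x Dx]; first by rewrite ltr_wpDl.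
    apply: (@le_trans _ _ c%:E); first by apply: ub; exists x.
    by rewrite lee_fin (le_trans (ler_norm c))// lerDl.
  (* Here the supremum is -oo, as for an empty [D], and any positive constant will do. *)
  exists 1 => // x Dx; apply: le_trans (leNye _).
  by apply: ub; exists x.
exists C => // x Dx; move: (w1 _ Dx) (hC _ Dx).
(* Where the weight is +oo the bound is trivial because [C] is positive. *)
case: (w x) => [v| |]//=; last by rewrite gt0_muley ?leey.
rewrite lee_fin => v1; have v0 : 0 < v by exact: lt_le_trans v1.
by rewrite inver gt_eqF// -EFinM !lee_fin ler_pdivrMr.
Qed.

Section lagrangian.
Context {R : realType} {dS dA : measure_display}
  {S : borelSpaceType R dS} {A : borelSpaceType R dA} (M : mdp S A).
Local Notation Q := (mdp_kernel M).
Local Notation K := (mdp_K M).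
Local Notation r := (mdp_r M).
Local Notation z := (mdp_z M).
Local Notation w := (mdp_w M).
Local Notation what := (mdp_what M).

Hypothesis r_le0 : forall x, K x -> r x <= 0.

Let mK : measurable K. Proof. exact: mdp_K_measurable. Qed.

Lemma mdp_w_ge1 x : K x -> (1 <= w x)%E.
Proof. by move=> /r_le0 rx; rewrite lee_fin; lra. Qed.

Lemma mdp_what_ge1 s : (1 <= what s)%E.
Proof.
rewrite /mdp_what -[leLHS]sube0 leeB//.
by apply: ge_ereal_sup => _ [a Aa <-]; rewrite lee_fin; exact: (r_le0 (s, a)).
Qed.

Lemma mdp_what_le_w x : K x -> (what x.1 <= w x)%E.
Proof.
move=> Kx; rewrite /mdp_what /mdp_w EFinB leeB//.
by apply: ereal_sup_ubound; exists x.2 => //; rewrite -surjective_pairing.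
Qed.

Hypothesis what_fin :
  forall x, K x -> (\int[Q x]_s what s)%E \is a fin_num.
Hypothesis what_weighted :
  weighted_functions K w (fun x => fine (\int[Q x]_s what s)%E).

Variable h : S -> R.
Hypothesis h_weighted : weighted_functions setT what h.

Let mh : measurable_fun setT h. Proof. by have [] := h_weighted. Qed.

Let mEh : measurable_fun setT (fun s => `|h s|%:E).
Proof. exact/measurable_EFinP/measurableT_comp. Qed.

(** Two weighted bounds are chained: [h] is dominated by a multiple of [what], whose integral under
    [Q] is dominated by a multiple of [w]. *)
Lemma integral_kernel_weighted_le : exists C : R, forall x, K x ->
  (\int[Q x]_s `|h s|%:E <= C%:E * w x)%E.
Proof.
have [C C0 hC] := weighted_functions_bound _ _ _ _ _ _
  (fun s _ => mdp_what_ge1 s) h_weighted.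
have [D D0 hD] := weighted_functions_bound _ _ _ _ _ _ mdp_w_ge1 what_weighted.
exists (C * D) => x Kx.
(* The constant sits on the side of [h]: pulling it out of an integral uses measurability, which is
   not known for [what]. *)
have le1 : (\int[Q x]_s (C^-1%:E * `|h s|%:E) <= \int[Q x]_s what s)%E.
  apply: ge0_le_integralT => s.
    by rewrite -EFinM lee_fin mulr_ge0// invr_ge0 ltW.
  by rewrite lee_pdivrMl//; exact: hC.
move: le1; rewrite ge0_integralZl//; last by rewrite lee_fin invr_ge0 ltW.
rewrite lee_pdivrMl// => /le_trans; apply.
rewrite EFinM -muleA lee_pmul2l//; apply: le_trans (hD _ Kx).
(* Finiteness matters here, since [fine] would send an infinite integral to 0. *)
by rewrite -[leLHS]fineK ?what_fin// lee_fin ler_norm.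
Qed.

Lemma integrable_kernel_weighted x : K x -> (Q x).-integrable setT (EFin \o h).
Proof.
move=> Kx; have [C hC] := integral_kernel_weighted_le.
apply/integrableP; split; first exact/measurable_EFinP.
by apply: le_lt_trans (hC _ Kx) _; rewrite /mdp_w -EFinM ltry.
Qed.

Variable mu : {charge set (S * A)%type -> \bar R}.
Hypotheses (mu_weighted : weighted_charges K w mu) (mu_ge0 : charge_ge0 mu).
Local Notation m := (charge_pos mu).

(** For a nonnegative charge the total variation integrates like the positive part, so membership in
    [weighted_charges] makes [w] an integrable majorant. *)
Lemma integrable_le_mdp_w (C : R) (f : S * A -> R) : measurable_fun K f ->
  (forall x, K x -> `|f x|%:E <= C%:E * w x)%E -> m.-integrable K (EFin \o f).
Proof.
move=> mf fw.
have iw : m.-integrable K w.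
  have mw : measurable_fun K w.
    by apply/measurable_EFinP/measurable_funB => //; exact: mdp_r_measurable.
  apply/integrableP; split => //.
  have [_] := mu_weighted; rewrite integral_charge_abs//; apply: le_lt_trans.
  rewrite (@eq_integral _ _ _ _ _ w)// => x /set_mem Kx.
  by rewrite gee0_abs// (le_trans _ (mdp_w_ge1 _ Kx)).
apply: (le_integrable mK _ _ (integrableZl mK C iw)).
  exact/measurable_EFinP.
by move=> x Kx; rewrite (le_trans (fw _ Kx))// lee_abs.
Qed.

Lemma integrable_mdp_r : m.-integrable K (EFin \o r).
Proof.
apply: (integrable_le_mdp_w 1); first exact: mdp_r_measurable.
move=> x Kx; rewrite mul1e lee_fin ler0_norm ?r_le0//.
by rewrite addrC lerDl.
Qed.

(** Since [mu] is nonnegative, [mdp_L0 M mu] is its marginal minus its image under [Q]. The weighted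
    bounds make [h] integrable against both, so [pairing_diff] splits the pairing and each term is
    pulled back to [K]. *)
Lemma pairing_mdp_L0 :
  [/\ m.-integrable K (EFin \o mdp_L0adj M h) &
      pairing setT (mdp_L0 M mu) h = \int[m]_(x in K) mdp_L0adj M h x].
Proof.
have mh1 : measurable_fun setT (h \o (@fst S A)).
  by apply: measurableT_comp => //; exact: measurable_fst.
have ih1 : m.-integrable K (EFin \o (h \o fst)).
  have [C C0 hC] := weighted_functions_bound _ _ _ _ _ _
    (fun s _ => mdp_what_ge1 s) h_weighted.
  apply: (integrable_le_mdp_w C); first exact: measurable_funTS.
  move=> x Kx; apply: (le_trans (hC x.1 I)).
  by rewrite lee_pmul2l//; exact: mdp_what_le_w.
(* The marginal is a pushforward from the whole product; having no mass off [K] reduces its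
   integrals to integrals over [K]. *)
have mKC0 : m (~` K) = 0%E.
  rewrite charge_pos_ge0//; last exact: measurableC.
  by have [+ _] := mu_weighted; apply => //; exact: measurableC.
have mKC : measurable (~` K) by exact: measurableC.
have ihT : m.-integrable setT (EFin \o (h \o fst)).
  have /integrableP[_ ioo] := ih1.
  apply/integrableP; split; first exact/measurable_EFinP.
  rewrite (ge0_negligible_integral mKC)//; first by rewrite setTD setCK.
  by apply: measurableT_comp => //; exact/measurable_EFinP.
have [iki ikE kE] : [/\ (kernel_image M m).-integrable setT (EFin \o h),
      m.-integrable K (fun x => (\int[Q x]_s h s)%:E) &
      \int[kernel_image M m]_s h s = \int[m]_(x in K) \int[Q x]_s h s].
  apply: Rintegral_kernel_image => //; last exact: integrable_kernel_weighted.
  have [C hC] := integral_kernel_weighted_le.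
  have iw : m.-integrable K (EFin \o (fun x => C * (1 - r x))).
    (* The sign of [C] is unknown, hence the absolute value. *)
    apply: (integrable_le_mdp_w `|C|) => [|x Kx].
      apply: measurable_funM => //; apply: measurable_funB => //.
      exact: mdp_r_measurable.
    rewrite /mdp_w -EFinM lee_fin normrM ler_wpM2l// ger0_norm// subr_ge0.
    exact: le_trans (r_le0 _ Kx) _.
  have /integrableP[_] := iw; apply: le_lt_trans; apply: ge0_le_integral => //.
  - by move=> x _; exact: integral_ge0.
  - exact: measurable_integral_kernel.
  - apply: measurableT_comp => //; exact: measurable_int iw.
  - by move=> x Kx; apply: (le_trans (hC _ Kx)); exact: lee_abs.
have iL : m.-integrable K (EFin \o mdp_L0adj M h).
  exact: (integrableB mK ih1 ikE).
split=> //.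
rewrite RintegralB// -kE.
have <- : \int[m]_x h x.1 = \int[m]_(x in K) h x.1.
  by rewrite /Rintegral (negligible_integral mKC)// setTD setCK.
have mEFh : measurable_fun setT (EFin \o h) by exact/measurable_EFinP.
have mpre (B : set S) : measurable B -> measurable (@fst S A @^-1` B).
  by move=> mB; rewrite -[X in measurable X]setTI; exact: measurable_fst.
have iP := integrable_pushforward (@measurable_fst _ _ S A) mEFh ihT
  measurableT.
rewrite (pairing_diff _ _ _ _ _ _ _ iP iki).
- by congr (_ - _);
    rewrite /Rintegral integral_pushforward//; exact: measurable_fst.
- by move=> B mB; rewrite /= fin_num_measure//; exact: mpre.
- by move=> B mB; exact: fin_num_measure.
- move=> B mB; rewrite mdp_L0E /= /pushforward.
  rewrite charge_pos_ge0//; last exact: mpre.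
  rewrite /kernel_image; congr (_ - _)%E.
  rewrite [X in (_ - X)%E](_ : _ = 0%E) ?sube0//.
  rewrite (eq_measure_integral mzero) ?integral_measure_zero//.
  by move=> C mC _; exact: charge_neg_ge0.
Qed.

End lagrangian.

(** * The Lagrangian as an integral over [K], and the dual function *)

Section duality.
Context {R : realType} {dS dA : measure_display}
  {S : borelSpaceType R dS} {A : borelSpaceType R dA} (M : mdp S A).
Local Notation Q := (mdp_kernel M).
Local Notation K := (mdp_K M).
Local Notation r := (mdp_r M).
Local Notation z := (mdp_z M).
Local Notation w := (mdp_w M).
Local Notation what := (mdp_what M).

Hypothesis r_le0 : forall x, K x -> r x <= 0.
Hypothesis z_bounded : [bounded z x | x in K].
Hypothesis what_fin :
  forall x, K x -> (\int[Q x]_s what s)%E \is a fin_num.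
Hypothesis what_weighted :
  weighted_functions K w (fun x => fine (\int[Q x]_s what s)%E).

Variables (a b : R) (y : R -> R).
Hypothesis my : measurable_fun setT y.
Hypothesis y_bounded :
  exists C : R, forall eta, eta \in `[a, b] -> `|y eta| <= C.

Let mK : measurable K. Proof. exact: mdp_K_measurable. Qed.

Lemma pairing_mdp_L1 (mu : {charge set (S * A)%type -> \bar R})
    (Lam : {charge set R -> \bar R}) : charge_ge0 mu -> charge_ge0 Lam ->
  (charge_pos mu).-integrable K (EFin \o mdp_L1adj M a b Lam) /\
  pairing `[a, b] Lam (fun eta => mdp_L1 M mu eta - y eta) =
    \int[charge_pos mu]_(x in K) mdp_L1adj M a b Lam x - pairing `[a, b] Lam y.
Proof.
move=> mu0 Lam0.
have [Cz zC] : exists C, forall x, K x -> `|z x| <= C.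
  (* Boundedness gives a bound by each number strictly above [C]. *)
  have [C [_ zC]] := z_bounded; exists (C + 1) => x Kx.
  by apply: (zC (C + 1)) => //; rewrite ltrDl.
have mab : measurable [set` `[a, b]] by exact: measurable_itv.
pose f (p : (S * A) * R) := negpart (z p.1 - p.2).
have mf : measurable_fun (K `*` [set` `[a, b]]) f.
  apply: measurable_minr => //; apply: measurable_funB.
    apply: (measurable_comp (F := K)) => //.
    - by move=> _ [p [Kp _] <-].
    - exact: mdp_z_measurable.
    - apply: measurable_funTS; exact: measurable_fst.
  apply: measurable_funTS; exact: measurable_snd.
(* The constant dominates the sum of the absolute values of [z x] and [eta]. *)
have fC x eta : K x -> [set` `[a, b]] eta ->
    `|f (x, eta)| <= Cz + (`|a| + `|b|).
  move=> /zC; rewrite ler_norml => /andP[z1 z2].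
  rewrite /= in_itv/= => /andP[ae eb].
  have := ler_norm b; have := ler_norm (- a); rewrite normrN.
  have := normr_ge0 a; have := normr_ge0 b => b0 a0 la lb.
  rewrite /f /negpart /= ler_norml ge_min le_min.
  by apply/andP; split; [apply/andP; split; lra|apply/orP; right; lra].
have [iF iG FG] := bounded_fubini (charge_pos mu) (charge_pos Lam) _ _ _ _
  mK mab mf fC.
have L1adjE x :
    mdp_L1adj M a b Lam x = \int[charge_pos Lam]_(eta in `[a, b]) f (x, eta).
  by rewrite /mdp_L1adj pairing_ge0.
have L1E eta : mdp_L1 M mu eta = \int[charge_pos mu]_(x in K) f (x, eta).
  by rewrite /mdp_L1 pairing_ge0.
have iy : (charge_pos Lam).-integrable `[a, b] (EFin \o y).
  have [C yC] := y_bounded.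
  by apply: (bounded_integrable _ _ _ _ _ _ C) => //; exact: measurable_funTS.
split; first by rewrite (funext L1adjE).
rewrite !pairing_ge0// (funext L1adjE) FG.
under eq_Rintegral do rewrite L1E.
by rewrite RintegralB.
Qed.

(** The part independent of [mu] is the objective: [beta] comes from the normalization term, the
    rest from [y]. Integrability of [g] is kept for comparing integrals and for its
    measurability. *)
Lemma lagrangianE (mu : {charge set (S * A)%type -> \bar R}) (h : S -> R)
    (beta : R) (Lam : {charge set R -> \bar R})
    (g := fun x => r x + mdp_L0adj M h x - beta + mdp_L1adj M a b Lam x) :
  weighted_charges K w mu -> charge_ge0 mu ->
  multipliers M a b (h, beta, Lam) ->
  (charge_pos mu).-integrable K (EFin \o g) /\
  lagrangian M a b y mu h (- beta) Lam =
    \int[charge_pos mu]_(x in K) g x + dual_objective a b y beta Lam.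
Proof.
move=> wmu mu0 [/= wh _ Lam0].
have ir := integrable_mdp_r M r_le0 mu wmu mu0.
have [i0 E0] := pairing_mdp_L0 M r_le0 what_fin what_weighted h wh mu wmu mu0.
have [i1 E1] := pairing_mdp_L1 mu Lam mu0 Lam0.
have i01 : (charge_pos mu).-integrable K
    (EFin \o (fun x => r x + mdp_L0adj M h x)).
  exact: (integrableD mK ir i0).
have ib : (charge_pos mu).-integrable K (EFin \o cst beta).
  exact: finite_measure_integrable_cst.
have i2 : (charge_pos mu).-integrable K
    (EFin \o (fun x => r x + mdp_L0adj M h x - beta)).
  exact: (integrableB mK i01 ib).
split; first exact: (integrableD mK i2 i1).
rewrite /lagrangian /dual_objective E0 E1 !pairing_ge0// /g.
rewrite (RintegralD mK i2 i1) (RintegralB mK i01 ib) (RintegralD mK ir i0).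
by rewrite !Rintegral_cst//; lra.
Qed.

(** The charge is [t] times the Dirac mass at [x]; its weighted mass is finite because [w x] is. *)
Lemma dirac_charge (x : S * A) (t : R) : K x -> 0 <= t ->
  exists2 mu : {charge set (S * A)%type -> \bar R},
    (weighted_charges K w `&` charge_ge0) mu &
    forall g : S * A -> R, measurable_fun K g ->
      \int[charge_pos mu]_(x in K) g x = t * g x.
Proof.
move=> Kx t0; pose mu := cscale t (charge_of_finite_measure (dirac x)).
have mu0 : charge_ge0 mu by move=> B mB; rewrite mule_ge0.
have dK : (\d_x K = 1 :> \bar R)%E by rewrite diracE mem_set.
have posE : forall B, measurable B -> B `<=` K ->
    charge_pos mu B = mscale (NngNum t0) (dirac x) B.
  by move=> B mB _; rewrite charge_pos_ge0.
have intE (f : S * A -> \bar R) : measurable_fun K f ->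
    (forall u, K u -> 0 <= f u)%E ->
    (\int[charge_pos mu]_(u in K) f u = t%:E * f x)%E.
  move=> mf f0; rewrite (eq_measure_integral _ posE) ge0_integral_mscale//=.
  by rewrite integral_dirac// dK mul1e.
exists mu => [|g mg].
  split=> //; split=> [B mB BK|].
    transitivity (t%:E * \d_x B)%E => //.
    by rewrite diracE memNset ?mule0// => /BK; exact.
  rewrite integral_charge_abs// intE.
  - by rewrite /mdp_w -EFinM ltry.
  - by apply/measurable_EFinP/measurable_funB => //; exact: mdp_r_measurable.
  - by move=> u /(mdp_w_ge1 M r_le0); apply: le_trans.
have mEg : measurable_fun K (EFin \o g) by exact/measurable_EFinP.
rewrite /Rintegral integralE.
rewrite (intE _ (measurable_funepos mEg))//.
rewrite (intE _ (measurable_funeneg mEg))//.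
(* Both parts of [g] are finite at [x], so [t] factors out of their difference. *)
rewrite -muleBr//; last by rewrite funerpos funerneg.
by rewrite -[X in (_ * X)%E](congr1 (@^~ x) (funeposneg (EFin \o g))).
Qed.

Lemma dual_functionE (h : S -> R) (beta : R) (Lam : {charge set R -> \bar R}) :
  multipliers M a b (h, beta, Lam) ->
  dual_function M a b y h (- beta) Lam =
    if `[< dual_constraint M a b h beta Lam >]
    then (dual_objective a b y beta Lam)%:E else +oo%E.
Proof.
move=> mult; rewrite /dual_function.
pose g x := r x + mdp_L0adj M h x - beta + mdp_L1adj M a b Lam x.
set V := [set _ | mu in _].
have Vdirac x t : K x -> 0 <= t ->
    V (t * g x + dual_objective a b y beta Lam)%:E.
  move=> Kx t0; have [mu [wmu mu0] muE] := dirac_charge x t Kx t0.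
  have [ig lE] := lagrangianE mu h beta Lam wmu mu0 mult.
  exists mu => //; rewrite lE muE//.
  by apply/measurable_EFinP; exact: measurable_int ig.
case: asboolP => [cons|/existsNP[x /not_implyP[Kx /negP]]].
  apply/eqP; rewrite eq_le; apply/andP; split.
    apply: ge_ereal_sup => _ [mu [wmu mu0] <-].
    have [ig ->] := lagrangianE mu h beta Lam wmu mu0 mult.
    rewrite lee_fin gerDr -oppr_ge0 -mulN1r -RintegralZl//.
    by apply: Rintegral_ge0 => x /cons; rewrite mulN1r oppr_ge0.
  apply: ereal_sup_ubound.
  have mu0 : charge_ge0 (czero : {charge set (S * A)%type -> \bar R}).
    by move=> B mB.
  have wmu : weighted_charges K w (czero : {charge set (S * A)%type -> \bar R}).
    (* The positive part of the zero charge passes through a chosen Hahn set; that it vanishes comes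
       from [charge_pos_ge0]. *)
    split=> //; rewrite integral_charge_abs// (eq_measure_integral mzero).
      by rewrite integral_measure_zero.
    by move=> B mB _; exact: (charge_pos_ge0 czero B mu0 mB).
  exists czero => //.
  have [_ ->] := lagrangianE czero h beta Lam wmu mu0 mult.
  rewrite /Rintegral (eq_measure_integral mzero).
    by rewrite integral_measure_zero add0r.
  by move=> B mB _; exact: (charge_pos_ge0 czero B mu0 mB).
rewrite -ltNge -/(g x) => gx0.
apply/eqP; rewrite -leye_eq leNgt; apply/negP => supoo.
(* A supremum below +oo would bound an affine function of [t] with positive slope [g x]. *)
have [C CV] : exists C : R, forall t, 0 <= t ->
    t * g x + dual_objective a b y beta Lam <= C.
  case: ereal_sup supoo (@ereal_sup_ubound _ V) => [C _ ub|//|_ ub].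
    by exists C => t t0; rewrite -lee_fin; exact/ub/Vdirac.
  by exists 0 => t t0; have := ub _ (Vdirac _ _ Kx t0).
set v := dual_objective _ _ _ _ _ in CV.
(* This [t] makes [t * g x] exceed [C - v]. *)
have := CV ((`|C - v| + 1) / g x); rewrite divfK ?gt_eqF//.
have -> : 0 <= (`|C - v| + 1) / g x by rewrite divr_ge0// ltW.
move=> /(_ isT); have := ler_norm (C - v); lra.
Qed.

End duality.

Theorem theorem4p2 (R : realType) (dS dA dT : measure_display)
  (S : borelSpaceType R dS) (A : borelSpaceType R dA) (M : mdp S A)
  (T : measurableType dT) (P : probability T R) (Y : {RV P >-> R}) (a b : R)
  (Y_support : P (Y @^-1` `[a, b]) = 1%E)
  (r_le0 : forall x, mdp_K M x -> mdp_r M x <= 0)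
  (r_compact : forall eps : R, 0 <= eps ->
     compact (mdp_K M `&` [set x | - eps <= mdp_r M x]))
  (z_bounded : [bounded mdp_z M x | x in mdp_K M])
  (z_usc : lower_semicontinuous
     (fun x : subspace (mdp_K M) => (- mdp_z M x)%:E))
  (Q_weakly_continuous : forall h : S -> R,
     continuous h -> [bounded h s | s in [set: S]] ->
     {within mdp_K M, continuous (fun x => \int[mdp_kernel M x]_s h s)} /\
     [bounded \int[mdp_kernel M x]_s h s | x in mdp_K M])
  (z_weighted : forall eta : R, eta \in `[a, b] ->
     weighted_functions (mdp_K M) (mdp_w M) (fun x => negpart (mdp_z M x - eta)))
  (what_fin : forall x, mdp_K M x ->
     (\int[mdp_kernel M x]_s mdp_what M s)%E \is a fin_num)
  (what_weighted : weighted_functions (mdp_K M) (mdp_w M)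
     (fun x => fine (\int[mdp_kernel M x]_s mdp_what M s)%E)) :
  let y := shortfall Y in
  (forall (h : S -> R) (beta : R) (Lam : {charge set R -> \bar R}),
     multipliers M a b (h, beta, Lam) ->
     dual_function M a b y h (- beta) Lam =
       if `[< dual_constraint M a b h beta Lam >]
       then (dual_objective a b y beta Lam)%:E else +oo%E) /\
  ereal_inf [set dual_function M a b y m.1.1 m.1.2 m.2 |
              m in multipliers M a b] =
  ereal_inf [set (dual_objective a b y m.1.2 m.2)%:E |
              m in [set m | multipliers M a b m /\
                            dual_constraint M a b m.1.1 m.1.2 m.2]].
Proof.
move=> y.
have y_bounded : exists C : R, forall eta, eta \in `[a, b] -> `|y eta| <= C.
  by exists (b - a) => eta etaab; exact: shortfall_bounded Y_support etaab.
have dualE := dual_functionE M r_le0 z_bounded what_fin what_weighted 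
  a b y (measurable_shortfall P Y) y_bounded.
split; first exact: dualE.
apply/eqP; rewrite eq_le; apply/andP; split.
  (* As [beta] is unrestricted in sign, negating it maps feasible points to multipliers. *)
  apply/ereal_infP => _ [[[h beta] Lam] [mult cons] <-].
  apply: ereal_inf_lbound; exists (h, - beta, Lam) => //=.
  by rewrite dualE//; case: asboolP.
apply/ereal_infP => _ [[[h beta] Lam] mult <-] /=.
(* Where the constraint fails the value is +oo and cannot lower the infimum. *)
rewrite -(opprK beta) dualE//; case: asboolP => [cons|_]; last exact: leey.
by apply: ereal_inf_lbound; exists (h, - beta, Lam).
Qed.
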